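(* For every closed formula $A$: if $\models_{\mathfrak R}A$ for every (uni)relational model $\mathfrak R$, then $\ell\mathsf{Kt}2\setminus\mathsf{cut}\vdash A$.
   Context: Formulas: $A ::= P \mid X \mid A\to B \mid \Box A \mid \blacksquare A \mid \forall X A$ over a set $\mathsf{Pr}$ of propositional symbols and second-order variables $X$; closed = no free variables; $A[C/X]$ capture-avoiding substitution. A (uni)relational structure $\mathfrak R$: set $W$ of worlds, class $\mathcal W\subseteq\mathcal P(W)$, $P_{\mathfrak R}\in\mathcal W$ for each $P\in\mathsf{Pr}$, $R\subseteq W\times W$. With each $V\in\mathcal W$ as a symbol interpreted as $V$: $v\models P$ iff $v\in P_{\mathfrak R}$; $v\models A\to B$ iff ($v\models A\Rightarrow v\models B$); $v\models\Box A$ iff $w\models A$ for all $w$ with $vRw$; $v\models\blacksquare A$ iff $u\models A$ for all $u$ with $uRv$; $v\models\forall XA$ iff $v\models A[V/X]$ for all $V\in\mathcal W$. $\models_{\mathfrak R}A$: true at every world. Relational model: comprehensive, i.e. $\{w:w\models C\}\in\mathcal W$ for every closed $C$ of the expanded language. Labelled sequents $\mathcal R\mid\Gamma\Rightarrow\Delta$: $\mathcal R$ a set of relational atoms $vRw$ between world symbols, $\Gamma,\Delta$ multisets of labelled formulas $v:A$ ($A$ closed). $\ell\mathsf{Kt}2$ rules (fresh = not in conclusion): id: $\mathcal R\mid v:A\Rightarrow v:A$; cut: from $\mathcal R\mid\Gamma\Rightarrow\Delta,v:A$ and $\mathcal R\mid\Gamma',v:A\Rightarrow\Delta'$ infer $\mathcal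 R\mid\Gamma,\Gamma'\Rightarrow\Delta,\Delta'$; weakening and contraction both sides; $\to$L: from $\mathcal R\mid\Gamma\Rightarrow\Delta,v:A$ and $\mathcal R\mid\Gamma',v:B\Rightarrow\Delta'$ infer $\mathcal R\mid\Gamma,\Gamma',v:A\to B\Rightarrow\Delta,\Delta'$; $\to$R: from $\mathcal R\mid\Gamma,v:A\Rightarrow\Delta,v:B$ infer $\mathcal R\mid\Gamma\Rightarrow\Delta,v:A\to B$; $\forall$L: from $\mathcal R\mid\Gamma,v:A[C/X]\Rightarrow\Delta$ infer $\mathcal R\mid\Gamma,v:\forall XA\Rightarrow\Delta$; $\forall$R: from $\mathcal R\mid\Gamma\Rightarrow\Delta,v:A[P/X]$ infer $\mathcal R\mid\Gamma\Rightarrow\Delta,v:\forall XA$, $P$ fresh; $\Box$L: from $\mathcal R,vRw\mid\Gamma,w:A\Rightarrow\Delta$ infer $\mathcal R,vRw\mid\Gamma,v:\Box A\Rightarrow\Delta$; $\Box$R: from $\mathcal R,vRw\mid\Gamma\Rightarrow\Delta,w:A$ infer $\mathcal R\mid\Gamma\Rightarrow\Delta,v:\Box A$, $w$ fresh; $\blacksquare$L: from $\mathcal R,uRv\mid\Gamma,u:A\Rightarrow\Delta$ infer $\mathcal R,uRv\mid\Gamma,v:\blacksquare A\Rightarrow\Delta$; $\blacksquare$R: from $\mathcal R,uRv\mid\Gamma\Rightarrow\Delta,u:A$ infer $\mathcal R\mid\Gamma\Rightarrow\Delta,v:\blacksquare A$, $u$ fresh. $\ell\mathsf{Kt}2\setminus\mathsf{cut}$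 omits cut. $\vdash A$ means proving $\emptyset\mid\emptyset\Rightarrow v:A$.
   Formalization: The set Pr of propositional symbols is assumed infinite, as the freshness condition in the rule ∀R requires; for finite Pr the claim fails (e.g. Pr empty and A = ∀X(X→X)). *)

(* Defs.v *)
From HB Require Import structures.
From mathcomp Require Import all_boot finmap multiset.
From mathcomp Require Import boolp classical_sets cardinality.

Set Implicit Arguments.
Unset Strict Implicit.
Unset Printing Implicit Defensive.

Local Open Scope classical_set_scope.
Local Open Scope mset_scope.
Local Open Scope fset_scope.

(* Formulas over a type S of propositional symbols, with second-order variables
   named by natural numbers. S is [Pr] for the object language, and
   [Pr + admissible sets] for the language expanded by a structure. *)
Inductive form (S : Type) : Type :=
| Sym of S
| Var of nat
| Imp of form S & form S
| Box of form S
| BBox of form S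
| All of nat & form S.

Arguments Var {S}.

Section Syntax.
Context {S : Type}.
Implicit Types A B C : form S.

Fixpoint fv A : seq nat :=
  match A with
  | Sym _ => [::]
  | Var X => [:: X]
  | Imp A B => fv A ++ fv B
  | Box A | BBox A => fv A
  | All X A => [seq Y <- fv A | Y != X]
  end.

Definition closed_form A : bool := nilp (fv A).

Fixpoint syms A : seq S :=
  match A with
  | Sym s => [:: s]
  | Var _ => [::]
  | Imp A B => syms A ++ syms B
  | Box A | BBox A | All _ A => syms A
  end.

(* A[C/X]. It is only ever used with C closed, in which case no variable can be
   captured and no bound variable has to be renamed. *)
Fixpoint subst (X : nat) C A : form S :=
  match A with
  | Sym s => Sym s
  | Var Y => if Y == X then C else Var Y
  | Imp A B => Imp (subst X C A) (subst X C B)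
  | Box A => Box (subst X C A)
  | BBox A => BBox (subst X C A)
  | All Y A => All Y (if Y == X then A else subst X C A)
  end.

Fixpoint height A : nat :=
  match A with
  | Sym _ | Var _ => 1
  | Imp A B => (maxn (height A) (height B)).+1
  | Box A | BBox A | All _ A => (height A).+1
  end.

Lemma height_subst_sym X s A : height (subst X (Sym s) A) = height A.
Proof.
elim: A => //= [Y|A -> B ->|A ->|A ->|Y A IH] //; first by case: ifP.
by case: ifP => //=; rewrite IH.
Qed.

End Syntax.

Fixpoint map_form (S T : Type) (f : S -> T) (A : form S) : form T :=
  match A with
  | Sym s => Sym (f s)
  | Var X => Var X
  | Imp A B => Imp (map_form f A) (map_form f B)
  | Box A => Box (map_form f A)
  | BBox A => BBox (map_form f A)
  | All X A => All X (map_form f A)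
  end.

(* A choiceType structure on formulas, needed to form multisets of them. *)
Fixpoint form_encode (S : Type) (A : form S) : GenTree.tree (S + nat) :=
  match A with
  | Sym s => GenTree.Leaf (inl s)
  | Var X => GenTree.Leaf (inr X)
  | Imp A B => GenTree.Node 0 [:: form_encode A; form_encode B]
  | Box A => GenTree.Node 1 [:: form_encode A]
  | BBox A => GenTree.Node 2 [:: form_encode A]
  | All X A => GenTree.Node X.+3 [:: form_encode A]
  end.

Fixpoint form_decode (S : Type) (t : GenTree.tree (S + nat)) :
    option (form S) :=
  match t with
  | GenTree.Leaf (inl s) => Some (Sym s)
  | GenTree.Leaf (inr X) => Some (Var X)
  | GenTree.Node 0 [:: t; u] =>
      if form_decode t is Some A then
        if form_decode u is Some B then Some (Imp A B) else None
      else None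
  | GenTree.Node 1 [:: t] => omap (@Box S) (form_decode t)
  | GenTree.Node 2 [:: t] => omap (@BBox S) (form_decode t)
  | GenTree.Node X.+3 [:: t] => omap (All X) (form_decode t)
  | _ => None
  end.

Lemma form_encodeK (S : Type) : pcancel (@form_encode S) (@form_decode S).
Proof. by elim=> //= [A -> B ->|A ->|A ->|X A ->]. Qed.

HB.instance Definition _ (S : eqType) :=
  Equality.copy (form S) (pcan_type (@form_encodeK S)).
HB.instance Definition _ (S : choiceType) :=
  Choice.copy (form S) (pcan_type (@form_encodeK S)).

Record structure (Pr : Type) : Type := Structure {
  world : Type;
  admissible : set (set world);
  interp : Pr -> set world;
  interp_admissible : forall P, admissible (interp P);
  acc : world -> world -> Prop
}.

Arguments admissible {Pr s} V : rename.
Arguments interp {Pr} s P _ : rename.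
Arguments acc {Pr s} v w : rename.

Section Semantics.
Context {Pr : Type} (M : structure Pr).

Definition xsym : Type := (Pr + {V : set (world M) | admissible V})%type.

Definition xinterp (s : xsym) : set (world M) :=
  match s with
  | inl P => interp M P
  | inr V => sval V
  end.

(* Truth at a world recurses on A[V/X] in the second-order case, which is not a
   subterm of the formula; n bounds the height. Only closed formulas matter, so
   the value at a variable is irrelevant. *)
Fixpoint sat_at (n : nat) (A : form xsym) (v : world M) : Prop :=
  if n is n.+1 then
    match A with
    | Sym s => xinterp s v
    | Var _ => False
    | Imp A B => sat_at n A v -> sat_at n B v
    | Box A => forall w, acc v w -> sat_at n A w
    | BBox A => forall u, acc u v -> sat_at n A u
    | All X A => forall V, sat_at n (subst X (Sym (inr V)) A) v
    end
  else False.

Definition sat (A : form xsym) (v : world M) : Prop := sat_at (height A) A v.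

Lemma sat_at_stable m n A v : height A <= m -> height A <= n ->
  sat_at m A v <-> sat_at n A v.
Proof.
elim: m n A v => [|m IHm] n A v; first by case: A.
case: n => [|n]; first by case: A.
case: A => //= [A B|A|A|X A].
- rewrite !ltnS !geq_max => /andP[mA mB] /andP[nA nB].
  by have [? ?] := (IHm n A v mA nA, IHm n B v mB nB); tauto.
- by move=> mA nA; split=> H w vw; apply/(IHm n A w mA nA)/H.
- by move=> mA nA; split=> H w vw; apply/(IHm n A w mA nA)/H.
- move=> mA nA; split=> H V; have := H V;
    by apply IHm; rewrite height_subst_sym.
Qed.

Lemma sat_atE n A v : height A <= n -> sat_at n A v <-> sat A v.
Proof. by move=> hA; apply: sat_at_stable. Qed.

(* The defining clauses of truth at a world. *)
Lemma sat_sym s v : sat (Sym s) v <-> xinterp s v.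
Proof. by []. Qed.

Lemma sat_imp A B v : sat (Imp A B) v <-> (sat A v -> sat B v).
Proof.
rewrite {1}/sat /=.
have [? ?] := (sat_atE v (leq_maxl (height A) (height B)),
               sat_atE v (leq_maxr (height A) (height B))).
by tauto.
Qed.

Lemma sat_box A v : sat (Box A) v <-> (forall w, acc v w -> sat A w).
Proof. by []. Qed.

Lemma sat_bbox A v : sat (BBox A) v <-> (forall u, acc u v -> sat A u).
Proof. by []. Qed.

Lemma sat_all X A v :
  sat (All X A) v <-> (forall V, sat (subst X (Sym (inr V)) A) v).
Proof.
by rewrite {1}/sat /=; split=> H V;
   apply/(@sat_atE (height A)) => //; rewrite height_subst_sym.
Qed.

Definition valid (A : form Pr) : Prop := forall v, sat (map_form inl A) v.

Definition comprehensive : Prop :=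
  forall C : form xsym, closed_form C -> admissible [set w | sat C w].

End Semantics.

Section Sequents.
Context {Pr : choiceType}.

(* Labelled formulas v : A, world symbols being natural numbers. *)
Local Notation lform := (nat * form Pr)%type.

Definition fresh_sym (P : Pr) (G D : {mset lform}) : Prop :=
  forall f : lform, f \in G `+` D -> P \notin syms f.2.

Definition fresh_world (w : nat) (R : {fset nat * nat}) (G D : {mset lform}) :
    Prop :=
  (forall a, a \in R -> (w != a.1) && (w != a.2)) /\
  (forall f : lform, f \in G `+` D -> w != f.1).

Implicit Types (u v w X : nat) (R : {fset nat * nat}) (G D : {mset lform})
  (A B C : form Pr).

(* Cut-free derivability of R | G => D. The closedness conditions are exactly
   what is needed for all the formulas of a derivable sequent to be closed. *)
Inductive cutfree : {fset nat * nat} -> {mset lform} -> {mset lform} -> Prop :=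
| cf_id R v A : closed_form A ->
    cutfree R [mset (v, A)] [mset (v, A)]
| cf_weakL R G D v A : closed_form A ->
    cutfree R G D ->
    cutfree R (G `+` [mset (v, A)]) D
| cf_weakR R G D v A : closed_form A ->
    cutfree R G D ->
    cutfree R G (D `+` [mset (v, A)])
| cf_contrL R G D v A :
    cutfree R (G `+` [mset (v, A)] `+` [mset (v, A)]) D ->
    cutfree R (G `+` [mset (v, A)]) D
| cf_contrR R G D v A :
    cutfree R G (D `+` [mset (v, A)] `+` [mset (v, A)]) ->
    cutfree R G (D `+` [mset (v, A)])
| cf_impL R G G' D D' v A B :
    cutfree R G (D `+` [mset (v, A)]) ->
    cutfree R (G' `+` [mset (v, B)]) D' ->
    cutfree R (G `+` G' `+` [mset (v, Imp A B)]) (D `+` D')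
| cf_impR R G D v A B :
    cutfree R (G `+` [mset (v, A)]) (D `+` [mset (v, B)]) ->
    cutfree R G (D `+` [mset (v, Imp A B)])
| cf_allL R G D v X A C : closed_form C ->
    cutfree R (G `+` [mset (v, subst X C A)]) D ->
    cutfree R (G `+` [mset (v, All X A)]) D
| cf_allR R G D v X A P :
    fresh_sym P G (D `+` [mset (v, All X A)]) ->
    cutfree R G (D `+` [mset (v, subst X (Sym P) A)]) ->
    cutfree R G (D `+` [mset (v, All X A)])
| cf_boxL R G D v w A :
    cutfree ((v, w) |` R) (G `+` [mset (w, A)]) D ->
    cutfree ((v, w) |` R) (G `+` [mset (v, Box A)]) D
| cf_boxR R G D v w A :
    fresh_world w R G (D `+` [mset (v, Box A)]) ->
    cutfree ((v, w) |` R) G (D `+` [mset (w, A)]) ->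
    cutfree R G (D `+` [mset (v, Box A)])
| cf_bboxL R G D u v A :
    cutfree ((u, v) |` R) (G `+` [mset (u, A)]) D ->
    cutfree ((u, v) |` R) (G `+` [mset (v, BBox A)]) D
| cf_bboxR R G D u v A :
    fresh_world u R G (D `+` [mset (v, BBox A)]) ->
    cutfree ((u, v) |` R) G (D `+` [mset (u, A)]) ->
    cutfree R G (D `+` [mset (v, BBox A)]).

Definition cutfree_provable A : Prop :=
  forall v : nat, cutfree fset0 mset0 [mset (v, A)].

End Sequents.

(* Main.v *)
(* A failed, fair cut-free proof search for A yields sets G and D of labelled
   formulas (left and right) closed under the rules read upwards. Without cut,
   G and D need not decide every formula, so, after Takahashi and Prawitz, a set
   V of worlds is called a possible value of C when G(C) <= V and V is disjoint
   from D(C); the admissible sets are the possible values of closed formulas.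
   By induction on A, truth of A[V1, ..., Vk] is a possible value of
   A[C1, ..., Ck] whenever each Vi is one of Ci. This gives comprehension and
   the falsity of every formula of D.
   As Pr may be uncountable, the search runs in a countably infinite sublanguage
   (symbols named by nat) containing A, onto which Pr is retracted. *)

Require Import Defs.
From HB Require Import structures.
From mathcomp Require Import all_boot finmap multiset.
From mathcomp Require Import boolp classical_sets functions cardinality.

Set Implicit Arguments.
Unset Strict Implicit.
Unset Printing Implicit Defensive.

Local Open Scope classical_set_scope.
Local Open Scope mset_scope.

(** Countability of formulas is what lets proof search enumerate all its tasks by codes in [nat]. *)
HB.instance Definition _ (S : countType) :=
  Countable.copy (form S) (pcan_type (@form_encodeK S)).

(** * Closed formulas and substitution *)

Section Syntax.
Context {S : Type}.
Implicit Types (A B C : form S).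

Lemma closed_imp A B :
  closed_form (Imp A B) = closed_form A && closed_form B.
Proof. by rewrite /closed_form /=; case: (fv A). Qed.

Lemma subst_notin_fv X C A : X \notin fv A -> subst X C A = A.
Proof.
elim: A => //= [Y|A IHA B IHB|A IH|A IH|Y A IH].
- by rewrite inE eq_sym => /negPf->.
- by rewrite mem_cat negb_or => /andP[/IHA-> /IHB->].
- by move=> /IH->.
- by move=> /IH->.
- by rewrite mem_filter eq_sym; case: eqP => //= _ /IH->.
Qed.

Lemma subst_closed X C A : closed_form A -> subst X C A = A.
Proof. by rewrite /closed_form => /nilP A0; rewrite subst_notin_fv ?A0. Qed.

Lemma fv_subst X C A : closed_form C ->
  fv (subst X C A) = [seq Y <- fv A | Y != X].
Proof.
move=> /nilP C0; elim: A => //= [Y|A IHA B IHB|Y A IH].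
- by case: eqP.
- by rewrite IHA IHB filter_cat.
- case: eqP => [->|/eqP YX].
    by rewrite -filter_predI; apply: eq_filter => Z /=; rewrite andbb.
  by rewrite IH -!filter_predI; apply: eq_filter => Z /=; rewrite andbC.
Qed.

Lemma closed_subst X C A : closed_form C ->
  closed_form (subst X C A) = closed_form (All X A).
Proof. by move=> cC; rewrite /closed_form fv_subst. Qed.

End Syntax.

(** * Renaming symbols and replacing them by formulas *)

Section Renaming.
Context {S : Type}.
Implicit Types (A C : form S).

(** Simultaneous instantiation A[C1, ..., Ck], with symbols serving as the parameters. It is applied
    to closed values only, so capture cannot occur. *)
Fixpoint bind (T : Type) (f : S -> form T) A : form T :=
  match A with
  | Sym s => f s
  | Var X => Var X
  | Imp A B => Imp (bind f A) (bind f B)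
  | Box A => Box (bind f A)
  | BBox A => BBox (bind f A)
  | All X A => All X (bind f A)
  end.

Lemma bind_subst_sym (T : Type) (f : S -> form T) X s A :
  (forall t, closed_form (f t)) ->
  bind f (subst X (Sym s) A) = subst X (f s) (bind f A).
Proof.
move=> cf; elim: A => //= [t|Y|A -> B ->|A ->|A ->|Y A IH] //.
- by rewrite subst_closed.
- by case: ifP.
- by case: ifP; rewrite ?IH.
Qed.

Lemma closed_bind (T : Type) (f : S -> form T) A :
  (forall s, closed_form (f s)) -> closed_form (bind f A) = closed_form A.
Proof.
move=> cf; rewrite /closed_form; congr nilp.
by elim: A => //= [s|A -> B ->|X A ->] //; apply/nilP/cf.
Qed.

Lemma map_form_id A : map_form id A = A.
Proof. by elim: A => //= [A -> B ->|A ->|A ->|X A ->]. Qed.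

Lemma map_form_comp (T U : Type) (h : S -> T) (g : T -> U) A :
  map_form g (map_form h A) = map_form (g \o h) A.
Proof. by elim: A => //= [A -> B ->|A ->|A ->|X A ->]. Qed.

Lemma fv_map_form (T : Type) (h : S -> T) A : fv (map_form h A) = fv A.
Proof. by elim: A => //= [A -> B ->|X A ->]. Qed.

Lemma closed_map_form (T : Type) (h : S -> T) A :
  closed_form (map_form h A) = closed_form A.
Proof. by rewrite /closed_form fv_map_form. Qed.

Lemma map_form_subst (T : Type) (h : S -> T) X C A :
  map_form h (subst X C A) = subst X (map_form h C) (map_form h A).
Proof.
elim: A => //= [Y|A -> B ->|A ->|A ->|Y A IH] //; first by case: ifP.
by case: ifP; rewrite ?IH.
Qed.

Lemma syms_map_form (T : Type) (h : S -> T) A :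
  syms (map_form h A) = map h (syms A).
Proof. by elim: A => //= A -> B ->; rewrite map_cat. Qed.

End Renaming.

Lemma bind_map_sym (S T : Type) (h : S -> T) (g : T -> form S) (A : form S) :
  (forall s, g (h s) = Sym s) -> bind g (map_form h A) = A.
Proof. by move=> gh; elim: A => //= [A -> B ->|A ->|A ->|X A ->]. Qed.

Lemma map_form_id_in (S : eqType) (h : S -> S) (A : form S) :
  {in syms A, h =1 id} -> map_form h A = A.
Proof.
elim: A => //= [s|A IHA B IHB|A IH|A IH|X A IH] hA.
- by rewrite hA ?inE.
- rewrite IHA ?IHB // => s sA; apply: hA; rewrite mem_cat sA ?orbT //.
- by rewrite IH.
- by rewrite IH.
- by rewrite IH.
Qed.

(** * Sequents up to weakening and contraction *)

Section Structural.
Context {Pr : choiceType}.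
Local Notation lform := (nat * form Pr)%type.
Implicit Types (R : {fset nat * nat}) (G D : {mset lform}) (s : seq lform).

Definition closed_seq (S : Type) (s : seq (nat * form S)) : bool :=
  all (fun f => closed_form f.2) s.

Lemma seq_mset_nil (K : choiceType) : seq_mset [::] = mset0 :> {mset K}.
Proof. by apply/msetP=> x; rewrite mset_seqE mset0E. Qed.

Lemma cutfree_weakL_seq R G D s : closed_seq s ->
  cutfree R G D -> cutfree R (G `+` seq_mset s) D.
Proof.
move=> + GD; elim: s => [|[v A] s IH]; first by rewrite seq_mset_nil msetD0.
move=> /andP[cA cs]; rewrite mset_cons msetDCA msetDC.
by apply: cf_weakL => //; apply: IH.
Qed.

Lemma cutfree_weakR_seq R G D s : closed_seq s ->
  cutfree R G D -> cutfree R G (D `+` seq_mset s).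
Proof.
move=> + GD; elim: s => [|[v A] s IH]; first by rewrite seq_mset_nil msetD0.
move=> /andP[cA cs]; rewrite mset_cons msetDCA msetDC.
by apply: cf_weakR => //; apply: IH.
Qed.

(** Brings a sequent with a surplus copy of [x] into the shape that the contraction rules expect. *)
Lemma mset_dup (x : lform) G (E : {mset lform}) : x \in G ->
  exists F, G `+` E = F `+` [mset x] /\
            G `+` (x +` E) = F `+` [mset x] `+` [mset x].
Proof.
move=> xG; exists ((G `\ x) `+` E); split; rewrite -{1}(msetB1K xG).
  by rewrite -msetDA msetDC.
by rewrite -msetDA msetDC msetDCA [x +` _]msetDC.
Qed.

Lemma cutfree_contrL_seq R G D s : {subset s <= G} ->
  cutfree R (G `+` seq_mset s) D -> cutfree R G D.
Proof.
elim: s => [|[v A] s IH] sG; first by rewrite seq_mset_nil msetD0.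
have vG : (v, A) \in G by apply: sG; rewrite inE eqxx.
rewrite mset_cons => H; apply: IH => [x xs|].
  by apply: sG; rewrite inE xs orbT.
have [F [-> E]] := mset_dup (seq_mset s) vG.
by apply: cf_contrL; rewrite -E.
Qed.

Lemma cutfree_contrR_seq R G D s : {subset s <= D} ->
  cutfree R G (D `+` seq_mset s) -> cutfree R G D.
Proof.
elim: s => [|[v A] s IH] sD; first by rewrite seq_mset_nil msetD0.
have vD : (v, A) \in D by apply: sD; rewrite inE eqxx.
rewrite mset_cons => H; apply: IH => [x xs|].
  by apply: sD; rewrite inE xs orbT.
have [F [-> E]] := mset_dup (seq_mset s) vD.
by apply: cf_contrR; rewrite -E.
Qed.

(** Weaken by all of [s] and [t], then contract away [G] and [D], whose members occur there already.
    Hence only the supports of the two multisets matter. *)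
Lemma cutfree_subset R G D s t : closed_seq s -> closed_seq t ->
  {subset G <= s} -> {subset D <= t} ->
  cutfree R G D -> cutfree R (seq_mset s) (seq_mset t).
Proof.
move=> cs ct Gs Dt H.
apply: (@cutfree_contrL_seq _ _ _ G) => [x|].
  by rewrite (perm_mem (perm_eq_seq_mset s)); apply: Gs.
apply: (@cutfree_contrR_seq _ _ _ D) => [x|].
  by rewrite (perm_mem (perm_eq_seq_mset t)); apply: Dt.
rewrite !seq_mset_id [X in cutfree _ X]msetDC [X in cutfree _ _ X]msetDC.
by apply: cutfree_weakL_seq => //; apply: cutfree_weakR_seq.
Qed.

End Structural.

(* The closure conditions of an open branch of exhaustive proof search: R holds
   its relational atoms, G and D the formulas on the left and on the right. *)
Record hintikka (S : Type) (R : nat -> nat -> Prop)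
    (G D : nat -> form S -> Prop) : Prop := {
  hk_id v A : G v A -> D v A -> False;
  hk_impL v A B : G v (Imp A B) -> D v A \/ G v B;
  hk_impR v A B : D v (Imp A B) -> G v A /\ D v B;
  hk_boxL v w A : G v (Box A) -> R v w -> G w A;
  hk_boxR v A : D v (Box A) -> exists2 w, R v w & D w A;
  hk_bboxL u v A : G v (BBox A) -> R u v -> G u A;
  hk_bboxR v A : D v (BBox A) -> exists2 u, R u v & D u A;
  hk_allL v X A C : G v (All X A) -> closed_form C -> G v (subst X C A);
  hk_allR v X A : D v (All X A) -> exists s, D v (subst X (Sym s) A)
}.

(** * The countermodel read off a saturated branch *)

Section Countermodel.
Context {Pr S : Type} (e : S -> Pr) (r : Pr -> S) (eK : cancel e r).
Context (R : nat -> nat -> Prop) (G D : nat -> form S -> Prop).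
Context (HK : hintikka R G D).

Definition possible_value (C : form S) (V : set nat) : Prop :=
  (forall v, G v C -> V v) /\ (forall v, D v C -> ~ V v).

Definition branch_admissible : set (set nat) :=
  [set V | exists2 C, closed_form C & possible_value C V].

Definition branch_interp (P : Pr) : set nat := [set v | G v (Sym (r P))].

Lemma possible_value_left (s : S) :
  possible_value (Sym s) [set v | G v (Sym s)].
Proof. by split=> // v Dv Gv; apply: hk_id HK _ _ Gv Dv. Qed.

Lemma branch_interp_admissible P : branch_admissible (branch_interp P).
Proof. by exists (Sym (r P)) => //; apply: possible_value_left. Qed.

Definition branch_model : structure Pr :=
  Structure branch_interp_admissible R.

Local Notation M := branch_model.

(* One admissible set may be paired with several names: the witness of hk_allR
   imposes its own name on its set, whatever other names the set may have. *)
Record named : Type := Named {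
  val_sym : xsym M;
  name : form S;
  name_closed : closed_form name;
  name_value : possible_value name (xinterp val_sym)
}.

(** The least possible value of the symbol [s], under the name [s]: the instance that falsifies a
    quantifier whose witness in [hk_allR] is [s]. *)
Definition all_witness (s : S) : named :=
  @Named (inr (exist _ [set v | G v (Sym s)]
                (ex_intro2 _ _ (Sym s) isT (possible_value_left s))))
         (Sym s) isT (possible_value_left s).

(** A symbol of [B] carries both a name and a value: [bind name] gives the syntactic instance met on
    the branch, [map_form val_sym] the semantic one. The induction is on height because the
    quantifier case passes to instances by symbols, which keep the height of the body. *)
Lemma sat_possible_value (B : form named) : closed_form B ->
  possible_value (bind name B) [set v | sat (map_form val_sym B) v].
Proof.
have [n] := ubnP (height B); elim: n B => // n IH [s|X|A B|A|A|X A] /=.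
- by move=> _ _; apply: name_value.
- by move=> _ /nilP.
- rewrite ltnS gtn_max => /andP[hA hB]; rewrite closed_imp => /andP[cA cB].
  have [GA DA] := IH A hA cA; have [GB DB] := IH B hB cB.
  split=> v /= => [/(hk_impL HK)[Av|Bv]|/(hk_impR HK)[Av Bv]].
  + by apply/sat_imp => /(DA _ Av).
  + by apply/sat_imp => _; apply: GB.
  + by move/sat_imp/(_ (GA _ Av)); apply: DB.
- move=> hA cA; have [GA DA] := IH A hA cA.
  split=> v /=; first by move=> Gv w vw; exact: GA (hk_boxL HK Gv vw).
  by move=> /(hk_boxR HK)[w vw Dw] /(_ w vw); apply: DA.
- move=> hA cA; have [GA DA] := IH A hA cA.
  split=> v /=; first by move=> Gv u uv; exact: GA (hk_bboxL HK Gv uv).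
  by move=> /(hk_bboxR HK)[u uv Du] /(_ u uv); apply: DA.
- rewrite ltnS => hA cA.
  have IHs (s : named) :
      possible_value (subst X (name s) (bind name A))
        [set v | sat (subst X (Sym (val_sym s)) (map_form val_sym A)) v].
    (* Both sides become images of the single formula [subst X (Sym s) A], to which the induction
       hypothesis applies. *)
    rewrite -(bind_subst_sym _ _ _ name_closed).
    rewrite -[Sym (val_sym s)]/(map_form val_sym (Sym s)) -map_form_subst.
    by apply: IH; rewrite ?height_subst_sym // closed_subst.
  split=> v /=.
    move=> Gv; apply/sat_all => -[V [C cC CV]].
    (* An admissible [V] comes with a closed [C] of which it is a possible value, and [hk_allL]
       covers every closed [C]. This is where impredicative instantiation is used. *)
    pose adm_V : branch_admissible V := ex_intro2 _ _ C cC CV.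
    have [Gs _] := IHs (@Named (inr (exist _ V adm_V)) C cC CV).
    exact: Gs (hk_allL HK Gv cC).
  move=> /(hk_allR HK)[s Ds] /sat_all.
  have [_ Ds'] := IHs (all_witness s).
  by move=> H; apply: (Ds' _ Ds); apply: H.
Qed.

Lemma named_surj (s : xsym M) : exists t : named, val_sym t = s.
Proof.
case: s => [P|[V adm_V]].
  by exists (@Named (inl P) (Sym (r P)) isT (possible_value_left _)).
have [C cC CV] := adm_V.
by exists (@Named (inr (exist _ V adm_V)) C cC CV).
Qed.

(** Choose a name for each symbol of the expanded language. Replacing symbols by names turns [C]
    into a closed formula of which the truth set of [C] is a possible value. *)
Lemma branch_model_comprehensive : comprehensive M.
Proof.
move=> C cC; have [f fK] := choice named_surj.
exists (bind name (map_form f C)).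
  by rewrite closed_bind ?closed_map_form //; apply: name_closed.
have := @sat_possible_value (map_form f C).
rewrite closed_map_form map_form_comp.
by rewrite (_ : val_sym \o f = id) ?map_form_id; [apply | apply/funext].
Qed.

Lemma branch_model_refutes v (A : form S) : closed_form A -> D v A ->
  ~ valid M (map_form e A).
Proof.
move=> cA Dv /(_ v).
(* Since [r (e s) = s], the symbol [e s] is interpreted by the left-hand occurrences of [s], so it
   may be named [Sym s]. *)
have Ve s : possible_value (Sym s) (xinterp (inl (e s) : xsym M)).
  by rewrite -{1}(eK s); apply: possible_value_left.
pose f s := @Named (inl (e s)) (Sym s) isT (Ve s).
have := @sat_possible_value (map_form f A).
rewrite closed_map_form map_form_comp bind_map_sym // => /(_ cA)[_ /(_ v Dv)].
by rewrite map_form_comp.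
Qed.

End Countermodel.

(** * Cut-free proof search, one rule at a time *)

Section Saturation.
Context {Pr : choiceType} (e : nat -> Pr) (e_inj : injective e).
Local Notation lform := (nat * form nat)%type.
Implicit Types (s t : seq lform) (v w : nat) (A B C : form nat).

Definition image_mset s : {mset nat * form Pr} :=
  seq_mset [seq (f.1, map_form e f.2) | f <- s].

(** Lists stand for sets here: the search only ever adds formulas, so principal formulas stay
    available for reuse, and contraction absorbs multiplicities. Formulas live over [nat], while
    derivability is judged on their images under [e]. *)
Record state := State {
  rel : {fset nat * nat};
  ant : seq lform;
  suc : seq lform
}.

Implicit Types (st : state).

Definition underivable st : Prop :=
  [/\ closed_seq (ant st), closed_seq (suc st) &
      ~ cutfree (rel st) (image_mset (ant st)) (image_mset (suc st))].

Definition extends st st' : Prop :=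
  [/\ {subset rel st <= rel st'}, {subset ant st <= ant st'} &
      {subset suc st <= suc st'}].

Lemma extends_refl st : extends st st.
Proof. by split. Qed.

Lemma extends_trans st2 st1 st3 :
  extends st1 st2 -> extends st2 st3 -> extends st1 st3.
Proof.
move=> [r12 a12 s12] [r23 a23 s23].
by split=> x => [/r12/r23|/a12/a23|/s12/s23].
Qed.

Definition add st (R : {fset nat * nat}) s t : state :=
  State (R `|` rel st)%fset (s ++ ant st) (t ++ suc st).

Lemma extends_add st R s t : extends st (add st R s t).
Proof.
by split=> x xst /=; rewrite ?mem_cat ?xst ?orbT // in_fsetU xst orbT.
Qed.

Lemma underivable_add st R s t : underivable st -> closed_seq s ->
  closed_seq t ->
  (cutfree (R `|` rel st)%fset (image_mset (s ++ ant st))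
     (image_mset (t ++ suc st)) -> False) ->
  underivable (add st R s t).
Proof.
move=> [ca cd _] cs ct nd.
by split; rewrite //= /closed_seq all_cat; apply/andP.
Qed.

Lemma mem_image_mset v A s :
  (v, A) \in s -> (v, map_form e A) \in image_mset s.
Proof.
by rewrite (perm_mem (perm_eq_seq_mset _)) => vA; apply/mapP; exists (v, A).
Qed.

Lemma image_msetP f s : f \in image_mset s ->
  exists2 g, g \in s & f = (g.1, map_form e g.2).
Proof. by rewrite (perm_mem (perm_eq_seq_mset _)) => /mapP. Qed.

Lemma image_mset_cons v A s :
  image_mset ((v, A) :: s) = image_mset s `+` [mset (v, map_form e A)].
Proof. by rewrite /image_mset /= mset_cons msetDC. Qed.

Lemma closed_image s :
  closed_seq [seq (f.1, map_form e f.2) | f <- s] = closed_seq s.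
Proof.
by rewrite /closed_seq all_map; apply: eq_all => f /=; rewrite closed_map_form.
Qed.

Lemma closed_seqP s v A : closed_seq s -> (v, A) \in s -> closed_form A.
Proof. by move=> /allP cs /cs. Qed.

(** Each search step ends here: the rule just applied yields a sequent made of formulas already
    present in the state, which [cutfree_subset] turns into a derivation of the state itself. *)
Lemma underivable_absurd st (X Y : {mset nat * form Pr}) : underivable st ->
  {subset X <= image_mset (ant st)} -> {subset Y <= image_mset (suc st)} ->
  cutfree (rel st) X Y -> False.
Proof.
move=> [ca cs nd] Xa Ys /cutfree_subset H; apply/nd/H; rewrite ?closed_image //.
  by move=> x /Xa; rewrite (perm_mem (perm_eq_seq_mset _)).
by move=> x /Ys; rewrite (perm_mem (perm_eq_seq_mset _)).
Qed.

Lemma fresh_bound (I : eqType) (r : seq I) (F : I -> seq nat) :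
  exists n, forall i, i \in r -> n \notin F i.
Proof.
set t := flatten (map F r); exists (\max_(k <- t) k).+1 => i ir.
apply/negP => nFi; have nt : (\max_(k <- t) k).+1 \in t.
  by apply/flattenP; exists (F i) => //; apply: map_f.
by have := @leq_bigmax_seq _ t xpredT id _ nt isT; rewrite ltnn.
Qed.

Lemma exists_fresh_sym s t : exists P,
  fresh_sym (e P) (image_mset s) (image_mset t).
Proof.
have [P hP] := fresh_bound (s ++ t) (fun f => syms f.2).
exists P => f; rewrite in_msetD => fst.
have [g gst ->] : exists2 g, g \in s ++ t & f = (g.1, map_form e g.2).
  by case/orP: fst => /image_msetP[g gs ->]; exists g => //;
     rewrite mem_cat gs ?orbT.
by rewrite /= syms_map_form mem_map //; apply: hP.
Qed.

Lemma exists_fresh_world (R : {fset nat * nat}) s t : exists w,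
  fresh_world w R (image_mset s) (image_mset t).
Proof.
(* Each label is encoded as a diagonal pair, so that one bound serves both the relational atoms and
   the labelled formulas. *)
have [w hw] := fresh_bound [:: enum_fset R; [seq (f.1, f.1) | f <- s ++ t]]
  (fun r => map fst r ++ map snd r).
exists w; split=> [a aR|f].
  have /hw : enum_fset R \in [:: enum_fset R; [seq (f.1, f.1) | f <- s ++ t]].
    by rewrite inE eqxx.
  rewrite mem_cat negb_or => /andP[w1 w2]; apply/andP; split.
    by apply: contraNneq w1 => ->; apply: map_f.
  by apply: contraNneq w2 => ->; apply: map_f.
rewrite in_msetD => fst.
have [g gst ->] : exists2 g, g \in s ++ t & f = (g.1, map_form e g.2).
  by case/orP: fst => /image_msetP[g gs ->]; exists g => //;
     rewrite mem_cat gs ?orbT.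
have /hw : [seq (f.1, f.1) | f <- s ++ t] \in
    [:: enum_fset R; [seq (f.1, f.1) | f <- s ++ t]] by rewrite !inE eqxx orbT.
rewrite mem_cat negb_or => /andP[w1 _] /=.
apply: contraNneq w1 => ->; rewrite -map_comp.
by apply/mapP; exists g.
Qed.

(** If both extensions were derivable, the left rule for implication would derive the state.
    Classical logic selects one that is not. *)
Lemma step_impL st v A B : underivable st ->
  (v, Imp A B) \in ant st ->
  exists st', [/\ underivable st', extends st st' &
                 (v, A) \in suc st' \/ (v, B) \in ant st'].
Proof.
move=> ud vAB; have [ca _ _] := ud.
have /andP[cA cB] : closed_form A && closed_form B.
  by rewrite -closed_imp; apply: closed_seqP vAB.
have [H1|H1] := pselect (underivable (add st fset0 [::] [:: (v, A)])).
  exists (add st fset0 [::] [:: (v, A)]).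
  by split; [|exact: extends_add|left; rewrite inE eqxx].
have [H2|H2] := pselect (underivable (add st fset0 [:: (v, B)] [::])).
  exists (add st fset0 [:: (v, B)] [::]).
  by split; [|exact: extends_add|right; rewrite inE eqxx].
exfalso; apply: H1; apply: underivable_add => //=.
  by rewrite /closed_seq /= cA.
rewrite image_mset_cons fset0U => H1.
apply: H2; apply: underivable_add => //=; first by rewrite /closed_seq /= cB.
rewrite image_mset_cons fset0U => H2.
apply: underivable_absurd (cf_impL H1 H2) => // x; rewrite !in_msetD ?orbb //.
by case/orP=> // /mset1P->; apply: (mem_image_mset vAB).
Qed.

Lemma step_impR st v A B : underivable st -> (v, Imp A B) \in suc st ->
  exists st', [/\ underivable st', extends st st' &
                 (v, A) \in ant st' /\ (v, B) \in suc st'].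
Proof.
move=> ud vAB; have [_ cs _] := ud.
have /andP[cA cB] : closed_form A && closed_form B.
  by rewrite -closed_imp; apply: closed_seqP vAB.
exists (add st fset0 [:: (v, A)] [:: (v, B)]).
split; [|exact: extends_add|by rewrite !inE !eqxx].
apply: underivable_add; rewrite /closed_seq /= ?cA ?cB //.
rewrite !image_mset_cons fset0U => /cf_impR; apply: underivable_absurd => // x.
by rewrite in_msetD => /orP[//|/mset1P->]; apply: (mem_image_mset vAB).
Qed.

Lemma step_boxL st v w A : underivable st ->
  (v, Box A) \in ant st -> (v, w) \in rel st ->
  exists st', [/\ underivable st', extends st st' & (w, A) \in ant st'].
Proof.
move=> ud vA vw; have [ca _ _] := ud.
have cA : closed_form A := closed_seqP ca vA.
exists (add st fset0 [:: (w, A)] [::]).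
split; [|exact: extends_add|by rewrite inE eqxx].
apply: underivable_add; rewrite /closed_seq /= ?cA // image_mset_cons fset0U.
(* The rule displays its atom; adding one that is already there changes nothing. *)
have -> : rel st = ((v, w) |` rel st)%fset by rewrite mem_fset1U.
move=> /cf_boxL; rewrite mem_fset1U //; apply: underivable_absurd => // x.
by rewrite in_msetD => /orP[//|/mset1P->]; apply: (mem_image_mset vA).
Qed.

Lemma step_boxR st v A : underivable st -> (v, Box A) \in suc st ->
  exists st', [/\ underivable st', extends st st' &
                 exists2 w, (v, w) \in rel st' & (w, A) \in suc st'].
Proof.
move=> ud vA; have [_ cs _] := ud.
have cA : closed_form A := closed_seqP cs vA.
(* The rule concludes with a further copy of the principal formula, so freshness is requested with
   that copy included. *)
have [w fw] := exists_fresh_world (rel st) (ant st) ((v, Box A) :: suc st).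
rewrite image_mset_cons in fw.
exists (add st [fset (v, w)]%fset [::] [:: (w, A)]); split.
- apply: underivable_add; rewrite /closed_seq /= ?cA // image_mset_cons.
  move=> /(cf_boxR fw); apply: underivable_absurd => // x.
  by rewrite in_msetD => /orP[//|/mset1P->]; apply: (mem_image_mset vA).
- exact: extends_add.
- by exists w; rewrite ?inE eqxx.
Qed.

Lemma step_bboxL st u v A : underivable st ->
  (v, BBox A) \in ant st -> (u, v) \in rel st ->
  exists st', [/\ underivable st', extends st st' & (u, A) \in ant st'].
Proof.
move=> ud vA uv; have [ca _ _] := ud.
have cA : closed_form A := closed_seqP ca vA.
exists (add st fset0 [:: (u, A)] [::]).
split; [|exact: extends_add|by rewrite inE eqxx].
apply: underivable_add; rewrite /closed_seq /= ?cA // image_mset_cons fset0U.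
have -> : rel st = ((u, v) |` rel st)%fset by rewrite mem_fset1U.
move=> /cf_bboxL; rewrite mem_fset1U //; apply: underivable_absurd => // x.
by rewrite in_msetD => /orP[//|/mset1P->]; apply: (mem_image_mset vA).
Qed.

Lemma step_bboxR st v A : underivable st -> (v, BBox A) \in suc st ->
  exists st', [/\ underivable st', extends st st' &
                 exists2 u, (u, v) \in rel st' & (u, A) \in suc st'].
Proof.
move=> ud vA; have [_ cs _] := ud.
have cA : closed_form A := closed_seqP cs vA.
have [u fu] := exists_fresh_world (rel st) (ant st) ((v, BBox A) :: suc st).
rewrite image_mset_cons in fu.
exists (add st [fset (u, v)]%fset [::] [:: (u, A)]); split.
- apply: underivable_add; rewrite /closed_seq /= ?cA // image_mset_cons.
  move=> /(cf_bboxR fu); apply: underivable_absurd => // x.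
  by rewrite in_msetD => /orP[//|/mset1P->]; apply: (mem_image_mset vA).
- exact: extends_add.
- by exists u; rewrite ?inE eqxx.
Qed.

Lemma step_allL st v X A C : underivable st ->
  (v, All X A) \in ant st -> closed_form C ->
  exists st', [/\ underivable st', extends st st' &
                 (v, subst X C A) \in ant st'].
Proof.
move=> ud vA cC; have [ca _ _] := ud.
have cA : closed_form (subst X C A).
  by rewrite closed_subst //; apply: closed_seqP vA.
exists (add st fset0 [:: (v, subst X C A)] [::]).
split; [|exact: extends_add|by rewrite inE eqxx].
apply: underivable_add; rewrite /closed_seq /= ?cA // image_mset_cons fset0U.
rewrite map_form_subst => /cf_allL; rewrite closed_map_form => /(_ cC).
apply: underivable_absurd => // x.
by rewrite in_msetD => /orP[//|/mset1P->]; apply: (mem_image_mset vA).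
Qed.

Lemma step_allR st v X A : underivable st -> (v, All X A) \in suc st ->
  exists st', [/\ underivable st', extends st st' &
                 exists P, (v, subst X (Sym P) A) \in suc st'].
Proof.
move=> ud vA; have [_ cs _] := ud.
have [P fP] := exists_fresh_sym (ant st) ((v, All X A) :: suc st).
rewrite image_mset_cons in fP.
have cA : closed_form (subst X (Sym P) A).
  by rewrite closed_subst //; apply: closed_seqP vA.
exists (add st fset0 [::] [:: (v, subst X (Sym P) A)]); split.
- apply: underivable_add; rewrite /closed_seq /= ?cA // image_mset_cons fset0U.
  rewrite map_form_subst => /(cf_allR fP); apply: underivable_absurd => // x.
  by rewrite in_msetD => /orP[//|/mset1P->]; apply: (mem_image_mset vA).
- exact: extends_add.
- by exists P; rewrite inE eqxx.
Qed.

(* (lhs, v, w, A, C) asks for the rule on v : A, on the left iff lhs holds, with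
   the world w or the formula C as instance (junk if the rule takes neither). *)
Local Notation task := (bool * nat * nat * form nat * form nat)%type.

Definition applicable (k : task) st : Prop :=
  let: (lhs, v, w, A, C) := k in
  (v, A) \in (if lhs then ant st else suc st) /\
  match lhs, A with
  | _, (Sym _ | Var _) => False
  | true, Box _ => (v, w) \in rel st
  | true, BBox _ => (w, v) \in rel st
  | true, All _ _ => closed_form C
  | _, _ => True
  end.

Definition handled (k : task) st : Prop :=
  let: (lhs, v, w, A, C) := k in
  match lhs, A with
  | _, (Sym _ | Var _) => False
  | true, Imp A B => (v, A) \in suc st \/ (v, B) \in ant st
  | false, Imp A B => (v, A) \in ant st /\ (v, B) \in suc st
  | true, (Box A | BBox A) => (w, A) \in ant st
  | false, Box A => exists2 w, (v, w) \in rel st & (w, A) \in suc st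
  | false, BBox A => exists2 u, (u, v) \in rel st & (u, A) \in suc st
  | true, All X A => (v, subst X C A) \in ant st
  | false, All X A => exists P, (v, subst X (Sym P) A) \in suc st
  end.

(** An inapplicable task leaves the state unchanged, so tasks can be tried in any order. *)
Lemma step st k : underivable st ->
  exists st', [/\ underivable st', extends st st' &
                 applicable k st -> handled k st'].
Proof.
move=> ud; have [ap|nap] := pselect (applicable k st); last first.
  by exists st; split=> //; apply: extends_refl.
suff [st' [? ? ?]] : exists st',
    [/\ underivable st', extends st st' & handled k st'] by exists st'.
case: k ap => [[[[[] v] w] A] C]; case: A => [s|X|A B|A|A|X A] /= [vA] //.
- by move=> _; apply: step_impL.
- exact: step_boxL.
- exact: step_bboxL.
- exact: step_allL.
- by move=> _; apply: step_impR.
- by move=> _; apply: step_boxR.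
- by move=> _; apply: step_bboxR.
- by move=> _; apply: step_allR.
Qed.

(** * A fair infinite branch and its limit *)

Section Branch.
Context (st0 : state) (st0_ud : underivable st0).

(** Stage n attempts the task encoded by n, if any. A task may become applicable only late, so each
    is paired with every index [i]: it then has infinitely many codes and is tried again after any
    given stage. *)
Lemma branch_exists : exists f : nat -> state,
  [/\ f 0 = st0, forall n, underivable (f n),
      forall n m, n <= m -> extends (f n) (f m) &
      forall k n, exists2 m, n <= m &
        applicable k (f m) -> handled k (f m.+1)].
Proof.
have next (p : {st | underivable st} * option (nat * task)) :
    exists q : {st | underivable st}, extends (sval p.1) (sval q) /\
      forall i k, p.2 = Some (i, k) ->
        applicable k (sval p.1) -> handled k (sval q).
  case: p => -[st ud] [[i k]|] /=.
    have [st' [ud' ex h]] := step k ud.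
    by exists (exist _ st' ud'); split=> // j l [_ <-].
  by exists (exist _ st ud); split=> //; apply: extends_refl.
have [g gP] := choice next.
pose f := fix f n := if n is n.+1 then g (f n, choice.unpickle n)
                     else exist _ st0 st0_ud.
exists (fun n => sval (f n)); split=> //.
- by move=> n; apply: svalP.
- move=> n m /subnK <-; elim: (m - n)%N => [|d IH]; first exact: extends_refl.
  apply: extends_trans IH _.
  by case: (gP (f (d + n)%N, choice.unpickle (d + n)%N)).
move=> k n.
have inj : injective (fun i : nat => choice.pickle (i, k)).
  by move=> i j /(pcan_inj choice.pickleK)[].
(* Distinct indices give distinct codes of [k], so some code exceeds [n]. *)
have [i /ltnW ni] := injective_gtn inj n.
exists (choice.pickle (i, k)) => //=; set p := choice.pickle _.
have [_] := gP (f p, choice.unpickle p); apply.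
by rewrite /= choice.pickleK.
Qed.

(** The limit is the union of the states. Premises found at different stages meet at their maximum,
    and since states only grow, a task applicable there stays applicable until fairness handles
    it. *)
Lemma hintikka_extension : exists R G D, hintikka R G D /\
  forall v A, (v, A) \in suc st0 -> D v A.
Proof.
have [f [f0 fud fext ffair]] := branch_exists.
pose R v w := exists n, (v, w) \in rel (f n).
pose G v A := exists n, (v, A) \in ant (f n).
pose D v A := exists n, (v, A) \in suc (f n).
have fair n lhs v w A C :
    (forall m, n <= m -> applicable (lhs, v, w, A, C) (f m)) ->
    exists m, handled (lhs, v, w, A, C) (f m).
  by move=> ap; have [m nm h] := ffair (lhs, v, w, A, C) n;
     exists m.+1; apply/h/ap.
have antM n m x : n <= m -> x \in ant (f n) -> x \in ant (f m).
  by move=> /fext[_ + _]; apply.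
have sucM n m x : n <= m -> x \in suc (f n) -> x \in suc (f m).
  by move=> /fext[_ _]; apply.
have relM n m x : n <= m -> x \in rel (f n) -> x \in rel (f m).
  by move=> /fext[+ _ _]; apply.
exists R, G, D; split.
- split.
  + move=> v A [n vA] [m vA'].
    have {}vA := antM _ _ _ (leq_maxl n m) vA.
    have {}vA' := sucM _ _ _ (leq_maxr n m) vA'.
    have [ca _ _] := fud (maxn n m).
    have cA : closed_form (map_form e A).
      by rewrite closed_map_form; apply: closed_seqP vA.
    (* A formula on both sides at a common stage would make that stage derivable from an identity
       axiom. *)
    apply: underivable_absurd (fud (maxn n m)) _ _ (cf_id _ v cA);
      by move=> x /mset1P->; apply: mem_image_mset.
  + move=> v A B [n vA].
    have [|m /=] := fair n true v 0 (Imp A B) A; last first.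
      by case=> ?; [left|right]; exists m.
    by move=> m nm; split=> //; apply: antM vA.
  + move=> v A B [n vA].
    have [|m [? ?]] := fair n false v 0 (Imp A B) A; last by split; exists m.
    by move=> m nm; split=> //; apply: sucM vA.
  + move=> v w A [n vA] [m vw].
    have [|l ?] := fair (maxn n m) true v w (Box A) A; last by exists l.
    move=> l; rewrite geq_max => /andP[nl ml].
    by split; [apply: antM vA|apply: relM vw].
  + move=> v A [n vA].
    have [|m [w vw wA]] := fair n false v 0 (Box A) A; last first.
      by exists w; exists m.
    by move=> m nm; split=> //; apply: sucM vA.
  + move=> u v A [n vA] [m uv].
    have [|l ?] := fair (maxn n m) true v u (BBox A) A; last by exists l.
    move=> l; rewrite geq_max => /andP[nl ml].
    by split; [apply: antM vA|apply: relM uv].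
  + move=> v A [n vA].
    have [|m [u uv uA]] := fair n false v 0 (BBox A) A; last first.
      by exists u; exists m.
    by move=> m nm; split=> //; apply: sucM vA.
  + move=> v X A C [n vA] cC.
    have [|m ?] := fair n true v 0 (All X A) C; last by exists m.
    by move=> m nm; split=> //; apply: antM vA.
  + move=> v X A [n vA].
    have [|m [P PA]] := fair n false v 0 (All X A) A; last by exists P, m.
    by move=> m nm; split=> //; apply: sucM vA.
- by move=> v A vA; exists 0; rewrite f0.
Qed.

End Branch.
End Saturation.

(** * Reduction to countably many symbols, and completeness *)

(** Enumerate the finitely many symbols of [A] first, then infinitely many others, which leaves
    fresh symbols at every stage of the search. *)
Lemma countable_sublanguage (Pr : choiceType) (A : form Pr) :
  infinite_set [set: Pr] ->
  exists (e : nat -> Pr) (r : Pr -> nat) (B : form nat),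
    cancel e r /\ map_form e B = A.
Proof.
move=> Pr_inf; pose s := undup (syms A).
have : infinite_set ([set: Pr] `\` [set` s]).
  by apply: infinite_setD => //; apply: finite_seq.
(* [f] maps the symbols outside [s] onto [nat]; a section [g] of it lists distinct such symbols, and
   [f] serves as their retraction. *)
move=> /infiniteP/pcard_geP[f].
have /choice[g gP] (n : nat) : exists P, P \notin s /\ f P = n.
  by have [P [_ /negP Ps] <-] := 'surj_f (I : setT n); exists P.
(* The default [g 0] is never returned, as [n] is in range. *)
pose e n := if n < size s then nth (g 0) s n else g (n - size s)%N.
pose r P := if P \in s then index P s else (size s + f P)%N.
have eK : cancel e r.
  move=> n; rewrite /e /r; case: ltnP => ns.
    by rewrite mem_nth // index_uniq // undup_uniq.
  by have [/negPf-> ->] := gP (n - size s)%N; rewrite subnKC.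
exists e, r, (map_form r A); split=> //.
rewrite map_form_comp; apply: map_form_id_in => P; rewrite -mem_undup -/s => Ps.
by rewrite /= /e /r Ps index_mem Ps nth_index.
Qed.

Theorem theorem5p1 (Pr : choiceType) (Pr_infinite : infinite_set [set: Pr])
    (A : form Pr) (A_closed : closed_form A) :
  (forall M : structure Pr, comprehensive M -> valid M A) ->
  cutfree_provable A.
Proof.
move=> A_valid v; apply: contrapT => nA.
have [e [r [B [eK eB]]]] := countable_sublanguage A Pr_infinite.
have cB : closed_form B by rewrite -(closed_map_form e) eB.
(* The image of this state under [e] is the sequent assumed to have no cut-free derivation. *)
have ud : underivable e (State fset0 [::] [:: (v, B)]).
  split; rewrite /closed_seq /= ?cB // /image_mset /= mset_cons seq_mset_nil.
  by rewrite msetD0 eB.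
have [R [G [D [HK /(_ v B)]]]] := hintikka_extension (can_inj eK) ud.
rewrite inE eqxx => /(_ isT) Dv.
apply: (branch_model_refutes (HK := HK) eK cB Dv).
by rewrite eB; apply/A_valid/branch_model_comprehensive.
Qed.
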